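(* Let $a,b,c\in\mathbb{R}$ be such that $a>-1$, $b>-1$ and $c>\max\{0,a-b\}$. Then the vector of weight functions $\left(\mathcal{W}(x;a,b,c),\ \mathcal{W}(x;a,b,c+1)\right)$ on the positive real line forms a Nikishin system.
   Context: For $\alpha>0$, $\beta\in\mathbb{R}$ and $x>0$, the confluent hypergeometric function of the second kind (Tricomi function) is $$\mathbf{U}(\alpha,\beta;x)=\frac{1}{\Gamma(\alpha)}\int_0^\infty t^{\alpha-1}(t+1)^{\beta-\alpha-1}e^{-tx}\,dt .$$ For $a>-1$, $b>-1$, $c>\max\{0,a-b\}$ and $x>0$ define $$\mathcal{W}(x;a,b,c)=\frac{\Gamma(c+b+1)}{\Gamma(a+1)\Gamma(b+1)}\,e^{-x}x^a\,\mathbf{U}(c,a-b+1;x).$$ Two measures $(\mu_0,\mu_1)$ form a Nikishin system (of order 2) if they are both supported on an interval $\Delta_0$ and there exists a positive measure $\sigma$ on an interval $\Delta_1$ with $\Delta_0\cap\Delta_1=\emptyset$ such that $$\frac{d\mu_1(x)}{d\mu_0(x)}=\int_{\Delta_1}\frac{d\sigma(t)}{x-t}\qquad (x\in\Delta_0).$$ The intervals are allowed to be unbounded and adjacent (their closures may touch at one point). A vector of weight functions $(w_0,w_1)$ on $(0,\infty)$ is identified with the pair of measures $(w_0(x)\,dx,\,w_1(x)\,dx)$, with $\Delta_0=(0,\infty)$. *)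

(* Defs.v *)
From HB Require Import structures.
From mathcomp Require Import all_boot all_order all_algebra.
From mathcomp Require Import all_classical all_reals all_analysis.

Set Implicit Arguments.
Unset Strict Implicit.
Unset Printing Implicit Defensive.

Import Order.TTheory GRing.Theory Num.Theory numFieldNormedType.Exports.

Local Open Scope classical_set_scope.
Local Open Scope ring_scope.

Definition Gamma (R : realType) (z : R) : R :=
  \int[@lebesgue_measure R]_(t in `]0, +oo[) (t `^ (z - 1) * expR (- t)).

Definition tricomiU (R : realType) (alpha beta x : R) : R :=
  (Gamma alpha)^-1 *
  \int[@lebesgue_measure R]_(t in `]0, +oo[)
    (t `^ (alpha - 1) * (t + 1) `^ (beta - alpha - 1) * expR (- (t * x))).

Definition weightW (R : realType) (a b c : R) (x : R) : R :=
  Gamma (c + b + 1) / (Gamma (a + 1) * Gamma (b + 1)) *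
  expR (- x) * x `^ a * tricomiU c (a - b + 1) x.

(* The library's 'd nu '/d mu requires a finite nu; this is its defining
   property, which makes sense for arbitrary measures and, when mu is
   sigma-finite, determines f mu-almost everywhere on D. *)
Definition is_RN_derivative (R : realType)
    (mu nu : {measure set (measurableTypeR R) -> \bar R}) (D : set R)
    (f : R -> R) : Prop :=
  measurable_fun D f /\
  forall A : set R, measurable A -> A `<=` D ->
    nu A = (\int[mu]_(x in A) (f x)%:E)%E.

(* Disjointness is only required of the intervals themselves: they may be
   unbounded, and their closures may share an endpoint. *)
Definition nikishin (R : realType) (D0 : set R)
    (mu0 mu1 : {measure set (measurableTypeR R) -> \bar R}) : Prop :=
  [/\ is_interval D0, mu0 (~` D0) = 0%E, mu1 (~` D0) = 0%E &
    exists (D1 : set R) (sigma : {measure set (measurableTypeR R) -> \bar R}),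
      [/\ is_interval D1, sigma (~` D1) = 0%E, D0 `&` D1 = set0,
          forall x, D0 x ->
            sigma.-integrable D1 (fun t : R => ((x - t)^-1)%:E) &
          is_RN_derivative mu0 mu1 D0
            (fun x => \int[sigma]_(t in D1) (x - t)^-1)]].

Definition weight_measure (R : realType) (D : set R) (w : R -> R)
    (mu : {measure set (measurableTypeR R) -> \bar R}) : Prop :=
  [/\ measurable_fun D w, forall x, D x -> 0 <= w x &
    forall A : set R, measurable A ->
      mu A = (\int[@lebesgue_measure R]_(x in A `&` D) (w x)%:E)%E].

Definition nikishin_weights (R : realType) (D0 : set R) (w0 w1 : R -> R)
    : Prop :=
  exists mu0 mu1 : {measure set (measurableTypeR R) -> \bar R},
    [/\ weight_measure D0 w0 mu0, weight_measure D0 w1 mu1 &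
        nikishin D0 mu0 mu1].

(* Main.v *)
Require Import Defs.
From HB Require Import structures.
From mathcomp Require Import all_boot all_order all_algebra.
From mathcomp Require Import all_classical all_reals all_analysis.
From mathcomp Require Import measurable_realfun complex spectral ring lra.

(** The quotient of the two weights is [(c + b + 1) U(c + 1) / U(c)], where [U]
    is taken at second parameter [a - b + 1], and the point is that this is the
    Stieltjes transform of a positive measure on the negative half-line.

    The two relations [tricomiU_by_parts] and [tricomiU_contiguous] between
    neighbouring Tricomi functions turn the quotient [U(c + 1) / U(c)] into an
    infinite continued fraction in [x] whose coefficients [c + n + 1] and
    [c + n + b - a] are positive; this is where [c > max(0, a - b)] enters. A
    truncation of the continued fraction is the corner entry of the resolvent at
    [-x] of a positive semidefinite Jacobi matrix ([cf_matrix_resolvent]), so by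
    the spectral theorem it equals a finite sum of terms [m i / (x + t i)] with
    nonnegative [m i] of sum one and nonnegative [t i] ([resolvent_entry_sum]).
    The truncations converge to the quotient for every [x > 0]
    ([cf_approx_cvg]): passing from one level to the previous one contracts
    relative errors by [g n / (g n + x)], and the product of these factors
    tends to zero because [g] grows linearly.

    It remains to extract a limit of the discrete probability measures. Each is
    represented by its quantile function, a monotone function with values in
    [[0, 1]] in the coordinate [1 / (1 + t)]; a limit of the quantile functions
    along an ultrafilter represents the quotient ([stieltjes_limit]), and the
    image of Lebesgue measure under that limit is the measure sought
    ([stieltjes_measure]). Mass may a priori escape to infinity, which does no
    harm because the kernel [1 / (x + t)] vanishes there. *)

Import Order.TTheory GRing.Theory Num.Theory numFieldNormedType.Exports.

Local Open Scope classical_set_scope.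
Local Open Scope ring_scope.

(** * Corner entries of resolvents *)

(** Diagonalise the Hermitian matrix [M M^T] by a unitary matrix [P]: the
    weights are the squared moduli of the entries in column [0] of [P], and the
    nodes are the eigenvalues, which are nonnegative because [P M M^T P^-1] is
    the product of [P M] with its adjoint. Since [P] does not depend on [x], one
    finite measure represents the entry for all [x > 0] simultaneously. *)
Lemma resolvent_entry_sum (R : rcfType) n (M : 'M[R]_n.+1) :
  exists m t : 'I_n.+1 -> R,
    [/\ forall i, 0 <= m i, forall i, 0 <= t i, \sum_i m i = 1 &
        forall x (w : 'cV[R]_n.+1), 0 < x ->
          (x%:M + M *m M^T) *m w = delta_mx 0 0 ->
          w 0 0 = \sum_i m i / (x + t i)].
Proof.
pose toC : {rmorphism R -> R[i]} := real_complex R.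
pose A : 'M[R[i]]_n.+1 := map_mx toC M.
pose H := A *m A^T.
have conj_toC (r : R) : (toC r)^* = toC r.
  exact: conjc_real.
have conjA : map_mx Num.conj A = A.
  by apply/matrixP => i j; rewrite !mxE conj_toC.
have H_herm : H \is hermsymmx.
  rewrite is_hermitianmxE expr0 scale1r /H trmx_mul trmxK map_mxM.
  by rewrite -map_trmx !conjA.
pose P := spectralmx H; pose d := spectral_diag H.
have PU : P \is unitarymx by exact: spectral_unitarymx.
have PPt : P *m (map_mx Num.conj P^T) = 1%:M by apply/unitarymxP.
have PtP : (map_mx Num.conj P^T) *m P = 1%:M by apply: mulmx1C.
have HE : H = (map_mx Num.conj P^T) *m diag_mx d *m P.
  by move: (hermitian_normalmx H_herm) => /orthomx_spectralP; rewrite invmx_unitary.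
have AtPt : A^T *m (map_mx Num.conj P^T) = map_mx Num.conj (P *m A)^T.
  by rewrite trmx_mul map_mxM -(map_trmx _ A) conjA.
have toC_ge0 (r : R) : (0 <= toC r) = (0 <= r) by exact: (lecR 0 r).
have dE i : d 0 i = \sum_k `|(P *m A) i k| ^+ 2.
  have /matrixP/(_ i i) : P *m H *m (map_mx Num.conj P^T) = diag_mx d.
    by rewrite HE -!mulmxA PPt mulmx1 mulmxA PPt mul1mx.
  rewrite [in RHS]mxE eqxx mulr1n => <-.
  rewrite /H mulmxA -(mulmxA _ A^T) [LHS]mxE; apply: eq_bigr => k _.
  rewrite normCK AtPt; congr (_ * _).
  by rewrite [LHS]mxE; congr (_ ^*); rewrite [LHS]mxE.
have d_ge0 i : 0 <= d 0 i by rewrite dE sumr_ge0// => k _; rewrite exprn_ge0.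
pose m i := complex.Re (`|P i 0| ^+ 2); pose t i := complex.Re (d 0 i).
have mE i : toC (m i) = `|P i 0| ^+ 2.
  by apply: RRe_real; rewrite ger0_real// exprn_ge0.
have tE i : toC (t i) = d 0 i by apply: RRe_real; rewrite ger0_real.
exists m, t; split.
- by move=> i; rewrite -toC_ge0 mE exprn_ge0.
- by move=> i; rewrite -toC_ge0 tE.
- apply: (fmorph_inj toC); rewrite rmorph_sum rmorph1.
  have /matrixP/(_ 0 0) := PtP; rewrite mxE [RHS]mxE /= => e.
  etransitivity; last exact: e.
  by apply: eq_bigr => i _; rewrite mE normCK mulrC !mxE.
- move=> x w x0 weq; apply: (fmorph_inj toC); rewrite rmorph_sum.
  pose W := map_mx toC w.
  have Weq : ((toC x)%:M + H) *m W = delta_mx 0 0.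
    have -> : delta_mx 0 0 = map_mx toC (delta_mx 0 0 : 'cV[R]_n.+1).
      by rewrite map_delta_mx.
    by rewrite -weq map_mxM map_mxD map_scalar_mx map_mxM -map_trmx.
  have PW i : (P *m W) i 0 = P i 0 / (toC x + d 0 i).
    have xd0 : toC x + d 0 i != 0.
      by rewrite gt_eqF// ltr_wpDr// lt0r fmorph_eq0 gt_eqF//= toC_ge0 ltW.
    have /(congr1 (mulmx P)) := Weq.
    have -> : P *m (((toC x)%:M + H) *m W) = ((toC x)%:M + diag_mx d) *m (P *m W).
      rewrite !mulmxDl mulmxDr !mul_scalar_mx -scalemxAr; congr (_ + _).
      by rewrite HE !mulmxA PPt mul1mx.
    move/matrixP/(_ i 0); rewrite -colE !mulmxDl mul_scalar_mx mul_diag_mx.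
    move: (P *m W) => v; rewrite !mxE -mulrDl => <-.
    by rewrite mulrAC mulfV// mul1r.
  have -> : toC (w 0 0) = ((map_mx Num.conj P^T) *m (P *m W)) 0 0.
    by rewrite mulmxA PtP mul1mx mxE.
  rewrite mxE; apply: eq_bigr => i _.
  have -> : toC (m i / (x + t i)) = `|P i 0| ^+ 2 / (toC x + d 0 i).
    by rewrite -mE -tE -rmorphD -fmorph_div.
  by rewrite PW normCK !mxE mulrA [in LHS](mulrC _ (P i 0)).
Qed.

(** * Truncations of a positive continued fraction *)

Section ContinuedFraction.
Variables (R : realType) (g a : nat -> R) (x : R).
Hypotheses (g_gt0 : forall n, 0 < g n) (a_gt0 : forall n, 0 < a n).

(** The tail [q n = (x + a n q (n + 1)) / (x + g n + a n q (n + 1))], cut by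
    putting [0] in place of [q (n + k)]. The value [0] is chosen because an
    unknown positive [q (n + k)] is then missed by a relative error of exactly
    one, whatever its size. *)
Fixpoint cf_tail (k n : nat) : R :=
  if k is k'.+1 then
    (x + a n * cf_tail k' n.+1) / (x + g n + a n * cf_tail k' n.+1)
  else 0.

Definition cf_approx (k n : nat) : R :=
  (x + g n + a n * cf_tail k n.+1)^-1.

Hypothesis x_gt0 : 0 < x.

Lemma cf_tail_ge0 k n : 0 <= cf_tail k n.
Proof.
elim: k n => [|k IH] n //=.
have aq : 0 <= a n * cf_tail k n.+1 by rewrite mulr_ge0// ltW.
by rewrite divr_ge0// !addr_ge0// ltW.
Qed.

Lemma cf_denom_gt0 k n : 0 < x + g n + a n * cf_tail k n.+1.
Proof. by rewrite ltr_wpDr// ?addr_gt0// mulr_ge0 ?cf_tail_ge0 ?ltW. Qed.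

Lemma cf_tailE k n : cf_tail k.+1 n = 1 - g n * cf_approx k n.
Proof.
rewrite /cf_approx /=; have := cf_denom_gt0 k n.
by set t := cf_tail _ _ => t0; field; rewrite gt_eqF.
Qed.

Lemma sum_ord_pick m n (F : nat -> R) :
  \sum_(j < m) F j *+ (n == j :> nat) = F n *+ (n < m)%N.
Proof.
elim: m => [|m IH]; first by rewrite big_ord0 ltn0.
rewrite big_ord_recr/= IH ltnS [in RHS]leq_eqVlt.
by case: eqVneq => [->|_]; rewrite ?ltnn /= ?mulr0n ?addr0 ?add0r.
Qed.

(** Bidiagonal factor of the Jacobi matrix with diagonal [g n + a n] and
    off-diagonal [sqrt (a n g (n + 1))]; factoring it shows that this matrix is
    positive semidefinite. The cut of the continued fraction corresponds to
    dropping [a N] from the last diagonal entry. *)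
Definition cf_matrix N : 'M[R]_N.+1 :=
  \matrix_(i, j) (Num.sqrt (g i) *+ (i == j :> nat) +
                  Num.sqrt (a i) *+ (i.+1 == j :> nat)).

(** First column of the resolvent of the Jacobi matrix, obtained by solving the
    tridiagonal system from the last row upwards. *)
Fixpoint cf_vector N n : R :=
  if n is n'.+1 then
    - (Num.sqrt (a n') * Num.sqrt (g n'.+1) * cf_approx (N - n'.+1) n'.+1
       * cf_vector N n')
  else cf_approx N 0.

Lemma cf_matrix_mul N (F : nat -> R) (i : 'I_N.+1) :
  (cf_matrix N *m (\col_j F j)) i 0 =
  Num.sqrt (g i) * F i + Num.sqrt (a i) * F i.+1 *+ (i.+1 < N.+1)%N.
Proof.
rewrite mxE.
under eq_bigr do rewrite !mxE mulrDl !mulrnAl.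
rewrite big_split/= (sum_ord_pick _ _ (fun j => Num.sqrt (g i) * F j)).
by rewrite (sum_ord_pick _ _ (fun j => Num.sqrt (a i) * F j)) ltn_ord.
Qed.

Lemma cf_matrix_tr_mul N (F : nat -> R) (j : 'I_N.+1) :
  ((cf_matrix N)^T *m (\col_i F i)) j 0 =
  Num.sqrt (g j) * F j +
  (if j : nat is j'.+1 then Num.sqrt (a j') * F j' else 0).
Proof.
rewrite mxE.
under eq_bigr do rewrite !mxE mulrDl !mulrnAl eq_sym.
rewrite big_split/= (sum_ord_pick _ _ (fun i => Num.sqrt (g i) * F i)) ltn_ord.
congr (_ + _).
case: j => -[|j] /= jN; first by rewrite big1.
under eq_bigr do rewrite eqSS eq_sym.
by rewrite (sum_ord_pick _ _ (fun i => Num.sqrt (a i) * F i)) (ltnW jN).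
Qed.

Lemma cf_matrix_resolvent N :
  (x%:M + cf_matrix N *m (cf_matrix N)^T) *m (\col_n cf_vector N n) =
  delta_mx 0 0.
Proof.
pose z n := Num.sqrt (g n) * cf_vector N n +
  (if n is n'.+1 then Num.sqrt (a n') * cf_vector N n' else 0).
have zE : (cf_matrix N)^T *m (\col_n cf_vector N n) = \col_n z n.
  apply/colP => j; rewrite [LHS]cf_matrix_tr_mul mxE /z.
  by case: j => -[].
rewrite mulmxDl mul_scalar_mx -mulmxA zE; apply/colP => i.
rewrite [LHS]mxE cf_matrix_mul !mxE eqxx andbT.
have sg n : Num.sqrt (g n) * Num.sqrt (g n) = g n.
  by rewrite -expr2 sqr_sqrtr// ltW.
have sa n : Num.sqrt (a n) * Num.sqrt (a n) = a n.
  by rewrite -expr2 sqr_sqrtr// ltW.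
have iN : (i <= N)%N by rewrite -ltnS.
(* the last row has no superdiagonal entry, which agrees with the right-hand
   side because the tail is zero there *)
have -> : Num.sqrt (a i) * z i.+1 *+ (i.+1 < N.+1)%N =
    a i * cf_tail (N - i) i.+1 * cf_vector N i.
  case: ltnP => [iN'|]; last first.
    rewrite ltnS => Ni; have -> : (N - i)%N = 0%N by apply/eqP.
    by rewrite /= mulr0 mul0r.
  rewrite /z /=.
  have -> : (N - i = (N - i.+1).+1)%N by rewrite subnSK.
  rewrite cf_tailE; move: (sa i) (sg i.+1) (cf_vector N i) (cf_approx _ _).
  by move: (Num.sqrt (a i)) (Num.sqrt (g _)) => s t <- <- w r; ring.
rewrite -(inj_eq val_inj)/=; move: iN; case: (i : nat) => [|n] nN.
  rewrite /z /= subn0 addr0 mulrA sg /cf_approx; have := cf_denom_gt0 N 0.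
  by set t := cf_tail _ _ => t0; field; rewrite gt_eqF.
rewrite /z mulrDr mulrA sg.
transitivity ((cf_approx (N - n.+1) n.+1)^-1 * cf_vector N n.+1 +
  Num.sqrt (g n.+1) * (Num.sqrt (a n) * cf_vector N n)).
  by rewrite /cf_approx invrK; ring.
rewrite /=; set r := cf_approx _ _.
have r0 : r != 0 by rewrite invr_neq0// gt_eqF// cf_denom_gt0.
by field.
Qed.

Section Convergence.
Variable q : nat -> R.
Hypothesis q_gt0 : forall n, 0 < q n.
Hypothesis qE : forall n,
  q n = (x + a n * q n.+1) / (x + g n + a n * q n.+1).

(** The map [T q = (x + a q) / (x + g + a q)] contracts relative errors by a
    factor at most [g / (g + x)]: infinitesimally, [q T'(q) / T(q)] is the
    product of [a q / (x + a q)] and [g / (x + g + a q)]. The error made by the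
    cut starts at relative size one. *)
Lemma cf_tail_error k n :
  `|cf_tail k n - q n| <= q n * \prod_(i < k) (g (n + i) / (g (n + i) + x)).
Proof.
elim: k n => [|k IH] n.
  by rewrite big_ord0 mulr1 sub0r normrN gtr0_norm.
rewrite big_ord_recl addn0.
under eq_bigr do rewrite /bump /= addnA addn1.
set Pi := \prod_(i < k) _.
have {IH} : `|cf_tail k n.+1 - q n.+1| <= q n.+1 * Pi by exact: IH.
have := cf_denom_gt0 k n; have := cf_tail_ge0 k n.+1.
rewrite /= (qE n); move: (cf_tail k n.+1) (q n.+1) (q_gt0 n.+1) => t s s0 t0 d0 IH.
have d1 : 0 < x + g n + a n * s by rewrite !addr_gt0// mulr_gt0.
have -> : (x + a n * t) / (x + g n + a n * t) -
          (x + a n * s) / (x + g n + a n * s) =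
   g n * a n / ((x + g n + a n * t) * (x + g n + a n * s)) * (t - s).
  by field; rewrite !gt_eqF.
rewrite normrM ger0_norm; last first.
  by rewrite divr_ge0 ?mulr_ge0// ltW.
have gx : 0 < g n + x by rewrite addr_gt0.
have Pi0 : 0 <= Pi by apply: prodr_ge0 => i _; rewrite divr_ge0 ?addr_ge0// ltW.
apply: (le_trans (ler_wpM2l _ IH)).
  by rewrite divr_ge0 ?mulr_ge0// ltW.
rewrite !mulrA; apply: ler_wpM2r => //.
rewrite -subr_ge0.
have -> : (x + a n * s) / (x + g n + a n * s) * g n / (g n + x) -
  g n * a n / ((x + g n + a n * t) * (x + g n + a n * s)) * s =
  g n * (x * (g n + x) + (a n * t) * (x + a n * s)) /
  ((x + g n + a n * s) * (g n + x) * (x + g n + a n * t)).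
  by field; rewrite !gt_eqF.
have at0 : 0 <= a n * t by rewrite mulr_ge0// ltW.
have as0 : 0 <= a n * s by rewrite mulr_ge0// ltW.
by rewrite divr_ge0 ?mulr_ge0 ?addr_ge0 ?mulr_ge0 ?addr_ge0// ltW.
Qed.

Variable C : R.
Hypothesis gC : forall n, g n <= C * n.+1%:R.

(** The inverse of the product is at least [1 + x * (1 / g 0 + 1 / g 1 + ...)],
    which diverges with the harmonic series when [g] grows at most linearly. *)
Lemma cf_rate_cvg0 : \prod_(i < n) (g i / (g i + x)) @[n --> \oo] --> (0 : R).
Proof.
have C0 : 0 < C by have := lt_le_trans (g_gt0 0) (gC 0); rewrite mulr1.
have sge0 k : 0 <= series (@harmonic R) k.
  by apply: sumr_ge0 => i _; exact: harmonic_ge0.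
have bound n : \prod_(i < n) (g i / (g i + x)) <=
    (1 + x / C * series harmonic n)^-1.
  have Pgt0 : 0 < \prod_(i < n) ((g i + x) / g i).
    by apply: prodr_gt0 => i _; rewrite divr_gt0 ?addr_gt0.
  rewrite -[leLHS]invrK lef_pV2 ?posrE; last 2 first.
  - by rewrite invr_gt0; apply: prodr_gt0 => i _; rewrite divr_gt0 ?addr_gt0.
  - by rewrite ltr_wpDr// mulr_ge0// divr_ge0// ltW.
  rewrite -prodfV; under eq_bigr do rewrite invf_div.
  elim: n {Pgt0} => [|n IH].
    by rewrite big_ord0 /series/= big_geq// mulr0 addr0.
  rewrite big_ord_recr/= seriesSr mulrDr addrA.
  have h0 : 0 <= x / C * harmonic n.
    by rewrite mulr_ge0// ?divr_ge0 ?harmonic_ge0// ltW.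
  have h1 : x / C * harmonic n <= x / g n.
    rewrite -mulrA; apply: ler_wpM2l; first exact: ltW.
    rewrite /harmonic/= -invfM lef_pV2 ?posrE//.
    by rewrite mulr_gt0.
  have -> : (g n + x) / g n = 1 + x / g n by field; rewrite gt_eqF.
  have := sge0 n; have : 0 <= x / C by rewrite divr_ge0 ?ltW.
  move: IH h0 h1.
  move: (\prod_(_ < _) _) (x / C * harmonic n) (x / g n) => P h h'.
  move: (x / C) (series harmonic n) => y s IH h0 h1 y0 s0.
  have ys : 0 <= y * s by exact: mulr_ge0.
  nra.
apply: (squeeze_cvgr (f := fun=> 0)
  (h := fun n => (1 + x / C * series harmonic n)^-1)).
- near=> n; rewrite bound andbT.
  by apply: prodr_ge0 => i _; rewrite divr_ge0 ?addr_ge0// ltW.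
- exact: cvg_cst.
- apply/gtr0_cvgV0.
    near=> n; rewrite ltr_wpDr//; apply: mulr_ge0; last exact: sge0.
    by rewrite divr_ge0 ?ltW.
  have series_y : series (@harmonic R) n @[n --> \oo] --> +oo.
    apply: nondecreasing_dvgn_lt; last exact: dvg_harmonic.
    by apply: nondecreasing_series => i _ _; exact: harmonic_ge0.
  apply/cvgryPge => A; near=> n.
  rewrite -lerBlDl -ler_pdivrMl ?divr_gt0//.
  near: n; exact: ((@cvgryPge _ _ _ _ _).1 series_y).
Unshelve. all: by end_near. Qed.

Lemma cf_approx_cvg :
  cf_approx N 0 @[N --> \oo] --> (x + g 0 + a 0 * q 1)^-1.
Proof.
have qE0 : (x + g 0 + a 0 * q 1)^-1 = (1 - q 0) / g 0.
  have aq : 0 < x + g 0 + a 0 * q 1 by rewrite !addr_gt0// mulr_gt0.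
  by rewrite (qE 0); field; rewrite !gt_eqF.
have rE N : cf_approx N 0 = (1 - cf_tail N.+1 0) / g 0.
  by rewrite cf_tailE; field; rewrite gt_eqF.
rewrite qE0; under eq_fun do rewrite rE.
apply: cvgMl; apply: cvgB; first exact: cvg_cst.
have err0 : q 0 * \prod_(i < N.+1) (g i / (g i + x)) @[N --> \oo] --> (0 : R).
  rewrite -[X in _ --> X](mulr0 (q 0)); apply: cvgMr.
  by have := cf_rate_cvg0; rewrite -cvg_shiftS.
apply/cvgrPdist_le => e e0; near=> N.
rewrite distrC; apply: (le_trans (cf_tail_error N.+1 0)).
by apply: (le_trans (ler_norm _)); near: N; move/cvgr0Pnorm_le: err0; exact.
Unshelve. all: by end_near. Qed.

End Convergence.
End ContinuedFraction.

(** * Limits of finite Stieltjes transforms *)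

Section Quantile.
Variable R : realType.
Implicit Types (x y t : R) (h Phi psi Y : R -> R) (s : seq (R * R)).

(** The hypothesis says that [Phi] is a primitive of the nondecreasing function
    [h]. Lower and upper sums then differ by [(h 1 - h 0) / (k + 1)], a bound
    that involves only the range of [h]; this uniformity is what lets the
    estimate survive a limit along an ultrafilter. *)
Lemma riemann_sandwich h Phi k :
  (forall u v, 0 <= u -> u <= v -> v <= 1 ->
     (v - u) * h u <= Phi v - Phi u <= (v - u) * h v) ->
  k.+1%:R^-1 * \sum_(j < k.+1) h (j%:R / k.+1%:R) <= Phi 1 - Phi 0
    <= k.+1%:R^-1 * \sum_(j < k.+1) h (j.+1%:R / k.+1%:R).
Proof.
move=> H.
have k0 : 0 < k.+1%:R :> R by rewrite ltr0n.
have -> : Phi 1 - Phi 0 =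
    \sum_(j < k.+1) (Phi (j.+1%:R / k.+1%:R) - Phi (j%:R / k.+1%:R)).
  rewrite -(big_mkord xpredT
    (fun j => Phi (j.+1%:R / k.+1%:R) - Phi (j%:R / k.+1%:R))).
  rewrite (telescope_sumr (fun j => Phi (j%:R / k.+1%:R)))//.
  by rewrite mul0r divff ?gt_eqF.
rewrite !mulr_sumr; have Hj (j : 'I_k.+1) :
    k.+1%:R^-1 * h (j%:R / k.+1%:R) <=
    Phi (j.+1%:R / k.+1%:R) - Phi (j%:R / k.+1%:R) <=
    k.+1%:R^-1 * h (j.+1%:R / k.+1%:R).
  have := H (j%:R / k.+1%:R) (j.+1%:R / k.+1%:R).
  rewrite -mulrBl -natrB// subSnn mul1r; apply.
  - by rewrite divr_ge0.
  - by rewrite ler_pM2r ?invr_gt0// ler_nat.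
  - by rewrite ler_pdivrMr// mul1r ler_nat.
by apply/andP; split; apply: ler_sum => j _; have /andP[] := Hj j.
Qed.

(** Quantile function of the discrete measure with mass [p.2] at [p.1], the list
    being sorted by position. The default value [1] is an upper bound of the
    positions, which keeps the function monotone beyond the total mass. *)
Fixpoint quantile s (u : R) : R :=
  if s is p :: s' then if u < p.2 then p.1 else quantile s' (u - p.2) else 1.

(** Primitive of [psi \o quantile s] that vanishes at [0], in closed form. *)
Fixpoint quantile_primitive psi s (u : R) : R :=
  if s is p :: s' then
    if u < p.2 then u * psi p.1
    else p.2 * psi p.1 + quantile_primitive psi s' (u - p.2)
  else u * psi 1.

Definition atoms s := all (fun p => (0 <= p.1 <= 1) && (0 <= p.2)) s.

Lemma quantile_bound s u y : y <= 1 -> all (fun p => y <= p.1) s ->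
  y <= quantile s u.
Proof.
by move=> y1; elim: s u => [|p s IH] u//= /andP[yp /IH]; case: ifP.
Qed.

Lemma quantile_itv s u : atoms s -> 0 <= quantile s u <= 1.
Proof.
move=> s_ok; apply/andP; split.
  by apply: quantile_bound => //; apply: sub_all s_ok => p /andP[/andP[]].
elim: s u s_ok => [|p s IH] u//= /andP[/andP[/andP[_ p1] _]] /IH.
by case: ifP.
Qed.

Lemma quantile_nd s u v : atoms s -> sorted (fun p q => p.1 <= q.1) s ->
  u <= v -> quantile s u <= quantile s v.
Proof.
elim: s u v => [|p s IH] u v//= /andP[/andP[/andP[_ p1] _] s_ok] srt uv.
have srt' : sorted (fun p q : R * R => p.1 <= q.1) s by exact: path_sorted srt.
case: ltP => up; case: ltP => vp//.
- apply: quantile_bound => //.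
  by apply: order_path_min srt => a b c; exact: le_trans.
- by have := lt_le_trans vp (le_trans up uv); rewrite ltxx.
- by apply: IH => //; rewrite lerD2r.
Qed.

Lemma quantile_primitive0 psi s : atoms s -> quantile_primitive psi s 0 = 0.
Proof.
elim: s => [|p s IH] /=; first by rewrite mul0r.
move=> /andP[/andP[_ p0] /IH s0].
case: ltP => [_|p0']; first by rewrite mul0r.
have -> : p.2 = 0 by apply/eqP; rewrite eq_le p0 p0'.
by rewrite mul0r add0r subr0.
Qed.

Lemma quantile_primitiveP psi s u v : {in `[0, 1] &, {homo psi : x y / x <= y}} ->
  atoms s -> sorted (fun p q => p.1 <= q.1) s -> u <= v ->
  (v - u) * psi (quantile s u) <=
    quantile_primitive psi s v - quantile_primitive psi s u <=
  (v - u) * psi (quantile s v).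
Proof.
move=> psi_nd; elim: s u v => [|p s IH] u v /=.
  by move=> _ _ uv; rewrite -mulrBl lexx.
move=> /andP[/andP[p01 p0] s_ok] srt uv.
have srt' : sorted (fun p q : R * R => p.1 <= q.1) s by exact: path_sorted srt.
have p_min : all (fun q => p.1 <= q.1) s.
  by apply: order_path_min srt => a b c; exact: le_trans.
have pq w : psi p.1 <= psi (quantile s w).
  apply: psi_nd; rewrite ?in_itv//= ?quantile_itv//.
  by apply: quantile_bound => //; case/andP: p01.
case: (ltP u) => up; case: (ltP v) => vp.
- by rewrite -mulrBl lexx.
- have vp0 : 0 <= v - p.2 by rewrite subr_ge0.
  have := IH 0 (v - p.2) s_ok srt' vp0.
  rewrite quantile_primitive0// !subr0.
  have := pq 0; have := pq (v - p.2).
  have : 0 <= p.2 - u by rewrite subr_ge0 ltW.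
  move: (quantile_primitive _ _ _) (psi _) (psi _) (psi _) => I a b c.
  move=> pu bc ac /andP[aI Ib].
  by apply/andP; split; nra.
- by have := lt_le_trans vp (le_trans up uv); rewrite ltxx.
- have := IH (u - p.2) (v - p.2) s_ok srt'; rewrite lerD2r => /(_ uv).
  have -> : v - p.2 - (u - p.2) = v - u by ring.
  by rewrite opprD addrACA subrr add0r.
Qed.

Lemma quantile_primitive_total psi s : atoms s ->
  quantile_primitive psi s (\sum_(p <- s) p.2) = \sum_(p <- s) p.2 * psi p.1.
Proof.
elim: s => [|p s IH] /=; first by rewrite !big_nil mul0r.
move=> /andP[/andP[_ p0] s_ok].
have s0 : 0 <= \sum_(q <- s) q.2.
  by rewrite big_seq; apply: sumr_ge0 => q /(allP s_ok)/andP[].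
by rewrite !big_cons ltNge lerDl s0/= (addrC p.2) addrK IH.
Qed.

(** Encodes all integrals against a finite probability measure on [[0, 1]] in a
    single monotone function, so that compactness can be applied to these
    functions instead of measures. *)
Lemma discrete_quantile n (m y : 'I_n -> R) :
  (forall i, 0 <= m i) -> \sum_i m i = 1 -> (forall i, 0 <= y i <= 1) ->
  exists Y, [/\ {homo Y : u v / u <= v}, forall u, 0 <= Y u <= 1 &
    forall psi k, {in `[0, 1] &, {homo psi : x y / x <= y}} ->
    k.+1%:R^-1 * \sum_(j < k.+1) psi (Y (j%:R / k.+1%:R)) <=
      \sum_i m i * psi (y i) <=
    k.+1%:R^-1 * \sum_(j < k.+1) psi (Y (j.+1%:R / k.+1%:R))].
Proof.
move=> m0 m1 y01.
pose s0 := [seq (y i, m i) | i <- index_enum 'I_n].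
pose s := sort (fun p q : R * R => p.1 <= q.1) s0.
have perm_s : perm_eq s s0 by rewrite perm_sort.
have s_ok : atoms s.
  rewrite /atoms (perm_all _ perm_s) /s0 all_map; apply/allP => i _ /=.
  by rewrite y01 m0.
have srt : sorted (fun p q : R * R => p.1 <= q.1) s.
  by apply: sort_sorted => p q; exact: le_total.
have sumE (F : R * R -> R) : \sum_(p <- s) F p = \sum_i F (y i, m i).
  by rewrite (perm_big _ perm_s) /s0 big_map.
exists (quantile s); split.
- by move=> u v; exact: quantile_nd.
- by move=> u; exact: quantile_itv.
- move=> psi k psi_nd.
  have := @riemann_sandwich (psi \o quantile s) (quantile_primitive psi s) k.
  rewrite quantile_primitive0// subr0 -m1 -(sumE snd) quantile_primitive_total//.
  rewrite (sumE (fun p => p.2 * psi p.1))/=; apply => u v _ uv _.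
  exact: quantile_primitiveP.
Qed.

(** The function [1 / (x + t)] in the coordinate [y = 1 / (1 + t)], which
    compactifies [[0, +oo[] to [[0, 1]]; at [y = 0], where mass lost at infinity
    would accumulate, it vanishes. *)
Definition stieltjes_kernel (x y : R) : R := y / (1 + (x - 1) * y).

Lemma stieltjes_kernel_denom_gt0 x y : 0 < x -> 0 <= y <= 1 ->
  0 < 1 + (x - 1) * y :> R.
Proof.
move=> x0 /andP[y0 y1]; have [->|y1'] := eqVneq y 1; first by rewrite mulr1; lra.
by have : y < 1 by [rewrite lt_neqAle y1' y1]; nra.
Qed.

Lemma stieltjes_kernel_nd x : 0 < x ->
  {in `[0, 1] &, {homo stieltjes_kernel x : y z / y <= z}}.
Proof.
move=> x0 y z; rewrite !in_itv/= => y01 z01 yz.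
rewrite /stieltjes_kernel ler_pdivrMr ?stieltjes_kernel_denom_gt0//.
rewrite mulrAC ler_pdivlMr ?stieltjes_kernel_denom_gt0//; nra.
Qed.

Lemma stieltjes_kernelE x t : 0 < x -> 0 <= t ->
  stieltjes_kernel x (1 + t)^-1 = (x + t)^-1.
Proof.
by move=> x0 t0; rewrite /stieltjes_kernel; field; rewrite !gt_eqF//; nra.
Qed.

Lemma stieltjes_kernel_itv x y : 0 < x -> 0 <= y <= 1 ->
  0 <= stieltjes_kernel x y <= x^-1.
Proof.
move=> x0 y01; have d0 := stieltjes_kernel_denom_gt0 x y x0 y01.
case/andP: (y01) => y0 y1; rewrite /stieltjes_kernel divr_ge0 ?(ltW d0)//=.
rewrite ler_pdivrMr// ler_pdivlMl//; nra.
Qed.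

Lemma cvg_stieltjes_kernel (T : Type) (F : set_system T) {FF : Filter F}
    (f : T -> R) (x l : R) : 0 < x -> 0 <= l <= 1 -> f @ F --> l ->
  stieltjes_kernel x (f t) @[t --> F] --> stieltjes_kernel x l.
Proof.
move=> x0 l01 fl; apply: cvgM => //; apply: cvgV.
  by rewrite gt_eqF// stieltjes_kernel_denom_gt0.
by apply: cvgD; [exact: cvg_cst|apply: cvgM => //; exact: cvg_cst].
Qed.

(** Helly selection. Along an ultrafilter the values at every [u] converge
    simultaneously by compactness of [[0, 1]], which replaces the extraction of
    a diagonal subsequence. *)
Lemma helly_ultrafilter (Y : nat -> R -> R) :
  (forall N, {homo Y N : u v / u <= v}) -> (forall N u, 0 <= Y N u <= 1) ->
  exists (F : set_system nat) (Z : R -> R),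
    [/\ ProperFilter F, \oo `<=` F, {homo Z : u v / u <= v},
        forall u, 0 <= Z u <= 1 & forall u, Y N u @[N --> F] --> Z u].
Proof.
move=> Y_nd Y01.
have [F [FU ooF]] := @ultraFilterLemma nat \oo _.
have FP : ProperFilter F by exact: ultra_proper.
have lim u : exists z : R, 0 <= z <= 1 /\ Y N u @[N --> F] --> z.
  have /(_ (Y ^~ u @ F) _)[|z [z01 zc]] := @segment_compact R 0 1.
    by apply: (@filterE _ F) => N; rewrite /= in_itv/= Y01.
  exists z; split; first by move: z01; rewrite /= in_itv.
  move=> B zB; have [//|FB] := in_ultra_setVsetC (Y ^~ u @^-1` B) FU.
  have [w [/= nBw Bw]] := zc (~` B) B FB zB.
  by exfalso; exact: nBw.
have [Z HZ] := choice lim.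
exists F, Z; split => //.
- move=> u v uv; apply: (ler_cvg_to (HZ u).2 (HZ v).2).
  by apply: filterE => N; exact: Y_nd.
- by move=> u; have [] := HZ u.
- by move=> u; have [] := HZ u.
Qed.

End Quantile.

Section MonotoneIntegral.
Variable R : realType.
Local Notation mu := (@lebesgue_measure R).

Lemma lebesgue_itv_finite (a b : bool) (u v : R) :
  (mu [set` Interval (BSide a u) (BSide b v)] < +oo)%E.
Proof.
by rewrite lebesgue_measure_itv/=; case: ifP => _; rewrite ?ltry// -EFinB ltry.
Qed.

Lemma nondecreasing_integrable (h : R -> R) (a b : bool) (u v : R) :
  {homo h : x y / x <= y} ->
  mu.-integrable [set` Interval (BSide a u) (BSide b v)] (EFin \o h).
Proof.
move=> h_nd; apply: measurable_bounded_integrable => //=.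
- exact: lebesgue_itv_finite.
- by apply: nondecreasing_measurable => // x y xy; exact: h_nd.
- exists (`|h u| + `|h v|); split; first by rewrite num_real.
  move=> M hM x /= xuv; apply/ltW; apply: le_lt_trans hM.
  have [ux xv] : u <= x /\ x <= v.
    by move: a b xuv => [] []; rewrite in_itv/= => /andP[p q]; split;
      rewrite // ltW.
  have := h_nd _ _ ux; have := h_nd _ _ xv.
  have := ler_norm (h u); have := ler_norm (- h u); rewrite normrN.
  have := ler_norm (h v); have := ler_norm (- h v); rewrite normrN.
  by move=> *; rewrite ler_norml; apply/andP; split; lra.
Qed.

Lemma nondecreasing_Rintegral_sandwich (h : R -> R) k :
  {homo h : x y / x <= y} ->
  k.+1%:R^-1 * \sum_(j < k.+1) h (j%:R / k.+1%:R) <=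
    \int[mu]_(u in `[0, 1]) h u <=
  k.+1%:R^-1 * \sum_(j < k.+1) h (j.+1%:R / k.+1%:R).
Proof.
move=> h_nd.
have := @riemann_sandwich R h (fun v => \int[mu]_(u in `[0, v]) h u) k.
rewrite set_itv1 Rintegral_set1 subr0; apply => u v u0 uv v1.
rewrite (@Rintegral_itvB _ h (BLeft 0) (BRight v)) ?bnd_simp//; last first.
  exact: nondecreasing_integrable.
have cstE c : (v - u) * c = \int[mu]_(t in `]u, v]) c.
  rewrite Rintegral_cst//= lebesgue_measure_itv/= lte_fin mulrC.
  have [uv'|vu] := ltP u v; first by rewrite -EFinB.
  have -> : v = u by apply/eqP; rewrite eq_le uv vu.
  by rewrite subrr.
have icst c : mu.-integrable `]u, v] (EFin \o (fun=> c)).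
  by apply: nondecreasing_integrable.
rewrite !cstE; apply/andP; split; apply: le_Rintegral => //.
- exact: nondecreasing_integrable.
- by move=> t /=; rewrite in_itv/= => /andP[/ltW ut _]; exact: h_nd.
- exact: nondecreasing_integrable.
- by move=> t /=; rewrite in_itv/= => /andP[_ tv]; exact: h_nd.
Qed.

(** Pass to quantile functions and to their limit along an ultrafilter. Both
    [g x] and the integral of the limit lie between the same Riemann sums, hence
    coincide. Dominated convergence is not available along an ultrafilter; the
    uniform estimate on Riemann sums of monotone functions takes its place. *)
Lemma stieltjes_limit (f : nat -> R -> R) (g : R -> R) :
  (forall N, exists n (m t : 'I_n -> R),
    [/\ forall i, 0 <= m i, forall i, 0 <= t i, \sum_i m i = 1 &
        forall x, 0 < x -> f N x = \sum_i m i / (x + t i)]) ->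
  (forall x, 0 < x -> f N x @[N --> \oo] --> g x) ->
  exists Y : R -> R,
    [/\ {homo Y : u v / u <= v}, forall u, 0 <= Y u <= 1 &
        forall x, 0 < x ->
          g x = \int[mu]_(u in `[0, 1]) stieltjes_kernel R x (Y u)].
Proof.
move=> f_sum f_cvg.
have f_quantile N : exists Y : R -> R,
    [/\ {homo Y : u v / u <= v}, forall u, 0 <= Y u <= 1 &
    forall x k, 0 < x ->
      k.+1%:R^-1 *
        \sum_(j < k.+1) stieltjes_kernel R x (Y (j%:R / k.+1%:R)) <=
      f N x <=
      k.+1%:R^-1 *
        \sum_(j < k.+1) stieltjes_kernel R x (Y (j.+1%:R / k.+1%:R))].
  have [n [m [t [m0 t0 m1 fE]]]] := f_sum N.
  have [|Y [Y_nd Y01 YP]] := @discrete_quantile R n m (fun i => (1 + t i)^-1) m0 m1.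
    by move=> i; rewrite invr_ge0 invf_le1 ?lerDl ?addr_ge0 ?t0// ltr_pwDl.
  exists Y; split => // x k x0; rewrite (fE x x0).
  have -> : \sum_i m i / (x + t i) =
      \sum_i m i * stieltjes_kernel R x (1 + t i)^-1.
    by apply: eq_bigr => i _; rewrite stieltjes_kernelE.
  exact: YP (stieltjes_kernel_nd R x x0).
have [Y YP] := choice f_quantile.
have [||F [Z [FP ooF Z_nd Z01 YZ]]] := @helly_ultrafilter R Y.
- by move=> N; have [] := YP N.
- by move=> N; have [] := YP N.
exists Z; split => // x x0.
have fF : f N x @[N --> F] --> g x by move=> B /(f_cvg x x0)/ooF.
pose h u := stieltjes_kernel R x (Z u).
have h_nd : {homo h : u v / u <= v}.
  by move=> u v uv; apply: stieltjes_kernel_nd; rewrite ?in_itv/= ?Z01// Z_nd.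
have sum_cvg k (p : nat -> R) :
    k.+1%:R^-1 * \sum_(j < k.+1) stieltjes_kernel R x (Y N (p j))
    @[N --> F] --> k.+1%:R^-1 * \sum_(j < k.+1) h (p j).
  apply: cvgMr; apply: cvg_big => [|j _]; first exact: add_continuous.
  exact: cvg_stieltjes_kernel.
have sandwich k : k.+1%:R^-1 * \sum_(j < k.+1) h (j%:R / k.+1%:R) <= g x <=
    k.+1%:R^-1 * \sum_(j < k.+1) h (j.+1%:R / k.+1%:R).
  apply/andP; split.
    apply: (ler_cvg_to (sum_cvg k (fun j => j%:R / k.+1%:R)) fF).
    by apply: filterE => N; have [_ _ /(_ x k x0)/andP[]] := YP N.
  apply: (ler_cvg_to fF (sum_cvg k (fun j => j.+1%:R / k.+1%:R))).
  by apply: filterE => N; have [_ _ /(_ x k x0)/andP[]] := YP N.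
have gap k : k.+1%:R^-1 * \sum_(j < k.+1) h (j.+1%:R / k.+1%:R) -
    k.+1%:R^-1 * \sum_(j < k.+1) h (j%:R / k.+1%:R) = k.+1%:R^-1 * (h 1 - h 0).
  rewrite -mulrBr -sumrB; congr (_ * _).
  rewrite -(big_mkord xpredT
    (fun j => h (j.+1%:R / k.+1%:R) - h (j%:R / k.+1%:R))).
  rewrite (telescope_sumr (fun j => h (j%:R / k.+1%:R)))//.
  by rewrite mul0r divff.
apply/eqP; rewrite -subr_eq0 -normr_le0; apply/ler_addgt0Pr => e e0; rewrite add0r.
have := @cvg_harmonic R; move/cvgrPdist_le.
pose M := h 1 - h 0 + 1.
have M0 : 0 < M by rewrite ltr_wpDl// subr_ge0 h_nd.
move=> /(_ (e / M)); rewrite divr_gt0// => /(_ isT) [k _ /(_ k (leqnn _))]/=.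
rewrite sub0r normrN ger0_norm// ler_pdivlMr// => kM.
have /andP[I1 I2] := nondecreasing_Rintegral_sandwich h k h_nd.
have /andP[g1 g2] := sandwich k.
have gap_e : k.+1%:R^-1 * (h 1 - h 0) <= e.
  by apply: le_trans kM; rewrite ler_pM2l// /M lerDl.
rewrite -gap in gap_e; move: I1 I2 g1 g2 gap_e.
rewrite ler_norml /h; move: (\int[mu]_(u in _) _) => I.
move: (k.+1%:R^-1 * _) (k.+1%:R^-1 * _) (g x) => A B G I1 I2 g1 g2 AB.
by apply/andP; split; lra.
Qed.
End MonotoneIntegral.

(** * Measures with a density *)

Section Density.
Context d (T : measurableType d) (R : realType).
Variables (mu : {measure set T -> \bar R}) (g : T -> R).
Hypotheses (mg : measurable_fun setT g) (g_ge0 : forall x, 0 <= g x).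

(** The two proofs are arguments so that the measure structure declared below
    can be inferred from the term alone. *)
Definition density of measurable_fun setT g & (forall x, 0 <= g x) :=
  fun A : set T => (\int[mu]_(x in A) (g x)%:E)%E.

Local Notation dens := (density mg g_ge0).

Let density0 : dens set0 = 0%E.
Proof. by rewrite /density integral_set0. Qed.

Let density_ge0 A : (0 <= dens A)%E.
Proof. by apply: integral_ge0 => x _; rewrite lee_fin. Qed.

Let density_sigma_additive : semi_sigma_additive dens.
Proof.
move=> /= F mF tF mUF; rewrite /density; apply: cvg_toP.
  apply: ereal_nondecreasing_is_cvgn => m n mn.
  apply: lee_sum_nneg_natr => // k _ _; apply: integral_ge0 => /= x Fkx.
  by rewrite lee_fin.
rewrite ge0_integral_bigcup//=.
- exact/measurable_funTS/measurable_EFinP.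
- by move=> x _; rewrite lee_fin.
Qed.

HB.instance Definition _ := isMeasure.Build _ _ _
  dens density0 density_ge0 density_sigma_additive.

End Density.
Arguments density {d T R} mu {g} _ _.

Import HBNNSimple.

(** Clear for simple functions; the general case follows by monotone
    convergence along simple approximations of [f]. *)
Lemma ge0_integral_density d (T : measurableType d) (R : realType)
    (mu nu : {measure set T -> \bar R}) (g : T -> R) (f : T -> \bar R) E :
  measurable_fun setT g -> (forall x, 0 <= g x) ->
  (forall A, measurable A -> nu A = \int[mu]_(x in A) (g x)%:E)%E ->
  measurable E -> measurable_fun E f -> (forall x, E x -> (0 <= f x)%E) ->
  (\int[nu]_(x in E) f x = \int[mu]_(x in E) (f x * (g x)%:E))%E.
Proof.
move=> mg g0 nuE mE mf f0; pose h := nnsfun_approx mE mf.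
have mgE D : measurable_fun D (EFin \o g).
  exact/measurable_funTS/measurable_EFinP.
have -> : (\int[nu]_(x in E) f x =
    lim (\int[nu]_(x in E) (EFin \o h n) x @[n --> \oo]))%E.
  have fE x : E x -> f x = lim ((EFin \o h n) x @[n --> \oo]).
    by move=> Ex; apply/esym/cvg_lim => //; exact: cvg_nnsfun_approx.
  under eq_integral => x /[!inE] /fE -> //.
  apply: monotone_convergence => //.
  - by move=> n; exact/measurable_EFinP/measurable_funTS.
  - by move=> n x Ex //=; rewrite lee_fin.
  - by move=> x Ex a b ab; rewrite lee_fin; exact/lefP/nd_nnsfun_approx.
have -> : (\int[mu]_(x in E) (f x * (g x)%:E) =
    lim (\int[mu]_(x in E) ((EFin \o h n) \* (EFin \o g)) x @[n --> \oo]))%E.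
  have fg x : E x -> (f x * (g x)%:E =
      lim (((EFin \o h n) \* (EFin \o g)) x @[n --> \oo]))%E.
    move=> Ex; apply/esym/cvg_lim => //; apply: cvgeZr => //.
    exact: cvg_nnsfun_approx.
  under eq_integral => x /[!inE] /fg -> //.
  apply: monotone_convergence => [//| | |].
  - move=> n; apply: emeasurable_funM => //.
    exact/measurable_EFinP/measurable_funTS.
  - by move=> n x Ex /=; rewrite mule_ge0 ?lee_fin.
  - move=> x Ex a b ab/=; rewrite lee_wpmul2r ?lee_fin//.
    exact/lefP/nd_nnsfun_approx.
suff suf n : (\int[mu]_(x in E) ((EFin \o h n) x * (g x)%:E) =
    \int[nu]_(x in E) (EFin \o h n) x)%E.
  by under eq_fun do rewrite -suf.
transitivity (\int[nu]_(x in E)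
   (\sum_(y \in range (h n)) (y * \1_(h n @^-1` [set y]) x)%:E))%E; last first.
  by apply: eq_integral => t tE; rewrite /= fimfunE -fsumEFin.
have indich m r : measurable_fun E (fun x => (r * \1_(h m @^-1` [set r]) x)%:E).
  by apply: (measurable_comp measurableT) => //; exact: measurable_funM.
rewrite ge0_integral_fsum//; last by move=> m y Ey; exact: nnfun_muleindic_ge0.
transitivity (\int[mu]_(x in E) (\sum_(y \in range (h n))
    (y * \1_(h n @^-1` [set y]) x)%:E * (g x)%:E))%E.
  under [RHS]eq_integral => x xE.
    rewrite -ge0_mule_fsuml => [|y]; last exact: nnfun_muleindic_ge0.
    rewrite fsumEFin // -(fimfunE _ x); over.
  by [].
rewrite ge0_integral_fsum//; last 2 first.
  - by move=> y; exact: emeasurable_funM.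
  - move=> m y Ey; apply: mule_ge0; first exact: nnfun_muleindic_ge0.
    by rewrite lee_fin.
apply: eq_fsbigr => r rhn.
under [RHS]eq_integral do rewrite EFinM.
rewrite integralZl_indic_nnsfun => //.
under eq_integral do rewrite EFinM -muleA.
rewrite ge0_integralZl//.
- under eq_integral do rewrite muleC.
  rewrite (eq_integral ((EFin \o g) \_ (h n @^-1` [set r]))); last first.
    by move=> x xE; rewrite epatch_indic.
  by rewrite -integral_mkcondr -nuE ?integral_indic// 1?setIC//; exact: measurableI.
- by apply: emeasurable_funM => //; exact/measurable_EFinP.
- by move=> t Et; rewrite mule_ge0 ?lee_fin.
- by move: rhn; rewrite inE => -[t _ <-]; rewrite lee_fin.
Qed.

(** * From quantile functions to representing measures *)

Section StieltjesMeasure.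
Variable R : realType.
Local Notation mu := (@lebesgue_measure R).

Lemma measurable_resolvent (x : R) : 0 < x ->
  measurable_fun (`]-oo, (0:R)]%classic) (fun t : R => (x - t)^-1).
Proof.
move=> x0; apply: (eq_measurable_fun (fun t : R => (x - t) `^ (-1))).
  move=> t; rewrite inE/= in_itv/= => t0.
  by rewrite powR_inv1// subr_ge0 (le_trans t0)// ltW.
apply: measurable_funTS; apply: (measurableT_comp (measurable_powR _)).
exact: measurable_funB.
Qed.

(** The measure is [kappa] times the image of Lebesgue measure on [[0, 1]] under
    the quantile function read in the coordinate [1 - 1 / y], restricted to the
    points where [Y] is positive: where [Y] vanishes the mass has escaped to
    infinity, and the kernel vanishes too. *)
Lemma stieltjes_measure (Y : R -> R) (kappa : R) : 0 <= kappa ->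
  {homo Y : u v / u <= v} -> (forall u, 0 <= Y u <= 1) ->
  exists sigma : {measure set (measurableTypeR R) -> \bar R},
    sigma (~` `]-oo, (0 : R)]) = 0%E /\
    forall x, 0 < x ->
      sigma.-integrable `]-oo, (0 : R)] (fun t : R => ((x - t)^-1)%:E) /\
      \int[sigma]_(t in `]-oo, (0 : R)]) (x - t)^-1 =
        kappa * \int[mu]_(u in `[0, 1]) stieltjes_kernel R x (Y u).
Proof.
move=> k0 Y_nd Y01.
have mY : measurable_fun setT Y.
  by apply: nondecreasing_measurable => // u v; exact: Y_nd.
(* a real power is used for the inverse because it is measurable on the whole
   line, with value 0 at 0 *)
pose Q u := 1 - Y u `^ (-1).
have QE u : Q u = 1 - (Y u)^-1 by rewrite /Q powR_inv1//; have /andP[] := Y01 u.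
have mQ : measurable_fun (setT : set (measurableTypeR R))
    (Q : _ -> measurableTypeR R).
  by apply: measurable_funB => //; exact: (measurableT_comp (measurable_powR _)).
pose E : set R := `[0, 1] `&` Y @^-1` `]0, +oo[.
have mE : measurable E.
  by apply: measurableI => //; rewrite -[X in measurable X]setTI; exact: mY.
pose g u := kappa * \1_E u.
have mg : measurable_fun (setT : set (measurableTypeR R)) g.
  by apply: measurable_funM => //; exact: measurable_indic.
have g0 u : 0 <= g u by rewrite mulr_ge0.
pose nu : {measure set (measurableTypeR R) -> \bar R} := density mu mg g0.
have [sigma [sigmaE sigma_int]] :
    exists sigma : {measure set (measurableTypeR R) -> \bar R},
    (forall A, sigma A = nu (Q @^-1` A)) /\
    (forall D (f : measurableTypeR R -> \bar R), measurable D ->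
       measurable_fun D f -> {in D, forall y, (0 <= f y)%E} ->
       \int[sigma]_(t in D) f t = \int[nu]_(u in Q @^-1` D) (f \o Q) u)%E.
  unshelve eexists
    (pushforward nu (Q : measurableTypeR R -> measurableTypeR R)) => //.
  by split => // D f mD mf f0; rewrite ge0_integral_pushforward.
have QEle u : E u -> Q u <= 0.
  move=> [_ /=]; rewrite in_itv/= andbT QE => Yu0.
  by rewrite subr_le0 invf_ge1//; have /andP[] := Y01 u.
exists sigma; split.
  rewrite sigmaE /nu /= /density.
  apply: integral0_eq => u /= Qu; rewrite /g indicE memNset ?mulr0//.
  by move=> /QEle; rewrite in_itv/= in Qu.
move=> x x0.
have mres := measurable_resolvent x x0.
have res0 t : `]-oo, (0 : R)]%classic t -> 0 <= (x - t)^-1.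
  by rewrite /= in_itv/= => t0; rewrite invr_ge0 subr_ge0 (le_trans t0)// ltW.
have h_nd : {homo (fun u => stieltjes_kernel R x (Y u)) : u v / u <= v}.
  by move=> u v uv; apply: stieltjes_kernel_nd; rewrite ?in_itv/= ?Y01// Y_nd.
have intE : (\int[sigma]_(t in `]-oo, 0%R]) ((x - t)^-1)%:E =
    \int[mu]_(u in `[0%R, 1%R]) (kappa * stieltjes_kernel R x (Y u))%:E)%E.
  rewrite sigma_int//=; last 2 first.
  - exact/measurable_EFinP.
  - by move=> t /set_mem /res0; rewrite lee_fin.
  have mQD : measurable (Q @^-1` `]-oo, (0:R)]).
    by rewrite -[X in measurable X]setTI; exact: mQ.
  rewrite (@ge0_integral_density _ _ _ mu nu g)//; last 2 first.
  - apply/measurable_EFinP; apply: (measurable_comp _ _ mres) => //.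
      by move=> _ [u Du <-].
    exact: measurable_funTS.
  - by move=> u /res0; rewrite lee_fin.
  rewrite integral_mkcond [RHS]integral_mkcond; apply: eq_integral => u _.
  rewrite !patchE /= /g indicE.
  have [uE|uE] := pselect (E u).
    have /andP[Y0 Y1] := Y01 u.
    rewrite !mem_set//=; last 2 first.
    - by case: uE.
    - by rewrite in_itv/=; exact: QEle.
    rewrite -EFinM; congr (_%:E); rewrite mulr1 mulrC; congr (_ * _).
    have Yu0 : 0 < Y u by case: uE => _; rewrite /= in_itv/= andbT.
    rewrite /stieltjes_kernel QE -[RHS]invf_div; congr (_^-1).
    by field; rewrite gt_eqF.
  rewrite (memNset uE) mulr0 mule0 if_same; case: ifPn => // /set_mem u01.
  suff -> : Y u = 0 by rewrite /stieltjes_kernel mul0r mulr0.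
  apply/eqP; rewrite eq_le; have /andP[-> _] := Y01 u; rewrite andbT leNgt.
  by apply/negP => Yu; apply: uE; split => //=; rewrite in_itv/= Yu.
have kint : mu.-integrable `[0, 1]
    (EFin \o (fun u => kappa * stieltjes_kernel R x (Y u))).
  by apply: nondecreasing_integrable => u v uv; rewrite ler_wpM2l// h_nd.
split.
  apply/integrableP; split; first exact/measurable_EFinP.
  under eq_integral => t /set_mem /res0 t0 do rewrite gee0_abs ?lee_fin//.
  rewrite intE -ge0_fin_numE; first exact: integrable_fin_num kint.
  apply: integral_ge0 => u _; rewrite lee_fin mulr_ge0//.
  by have /andP[] := @stieltjes_kernel_itv R x (Y u) x0 (Y01 u).
by rewrite /Rintegral intE -RintegralZl//; exact: nondecreasing_integrable.
Qed.

End StieltjesMeasure.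

(** * The integrals behind the Tricomi function *)

Section TricomiIntegrals.
Variable R : realType.
Local Notation mu := (@lebesgue_measure R).
Implicit Types p s x t : R.

Definition tricomi_integrand p s x t :=
  t `^ p * (t + 1) `^ s * expR (- (t * x)).

Local Notation k := tricomi_integrand.

Lemma tricomi_integrand_ge0 p s x t : 0 <= k p s x t.
Proof. by rewrite !mulr_ge0 ?powR_ge0 ?expR_ge0. Qed.

Lemma tricomi_integrand_gt0 p s x t : 0 < t -> 0 < k p s x t.
Proof. by move=> t0; rewrite !mulr_gt0 ?powR_gt0 ?expR_gt0// addr_gt0. Qed.

Lemma measurable_tricomi_integrand p s x : measurable_fun setT (k p s x).
Proof.
apply: measurable_funM; first apply: measurable_funM.
- exact: measurable_powR.
- by apply: (measurableT_comp (measurable_powR _)); exact: measurable_funD.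
- by do 2 apply: measurableT_comp => //; exact: measurable_funM.
Qed.

Lemma powR_succ p t : 0 < t -> t `^ (p + 1) = t `^ p * t.
Proof.
by move=> t0; rewrite powRD ?powRr1 ?(ltW t0)//; rewrite (gt_eqF t0) implybT.
Qed.

Lemma tricomi_integrand_split p s x t : 0 < t ->
  k p (s + 1) x t = k (p + 1) s x t + k p s x t.
Proof.
by move=> t0; rewrite /k !powR_succ ?addr_gt0//; ring.
Qed.

Lemma is_derive_tricomi_integrand p s x t : 0 < t ->
  is_derive t 1 (k p s x)
    (p * k (p - 1) s x t + s * k p (s - 1) x t - x * k p s x t).
Proof.
move=> t0.
have t10 : 0 < t + 1 by rewrite addr_gt0.
have d1 : is_derive t 1 (fun u : R => u `^ p) (p * t `^ (p - 1)).
  exact: is_derive1_powR.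
have d2 : is_derive t 1 ((fun u => u `^ s) \o (id + cst 1))
    (s * (t + 1) `^ (s - 1)).
  have da : is_derive t 1 (id + cst 1 : R -> R) 1.
    by rewrite -[X in is_derive _ _ _ X](addr0 (1 : R)); exact: is_deriveD.
  have db := is_derive1_powR s t10.
  by rewrite -[X in is_derive _ _ _ X]mulr1; exact: is_derive1_comp.
have d3 : is_derive t 1 (expR \o (cst (- x) * id)) (expR (- x * t) * - x).
  have da : is_derive t 1 (cst (- x) * id : R -> R) (- x).
    apply: (is_derive_eq
      (is_deriveM (is_derive_cst (- x) t 1) (is_derive_id t 1))).
    by rewrite scaler0 addr0 [LHS]mulr1.
  exact: is_derive1_comp.
have d123 := is_deriveM (is_deriveM d1 d2) d3.
have -> : k p s x = ((fun u => u `^ p) * ((fun u => u `^ s) \o (id + cst 1))) *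
    (expR \o (cst (- x) * id)).
  apply/funext => u; rewrite /k !fctE /=; congr (_ * expR _).
  by rewrite mulNr mulrC.
apply: (is_derive_eq d123); rewrite /k !fctE /GRing.scale/= mulNr (mulrC x); ring.
Qed.


Lemma derivable_tricomi_integrand p s x t : 0 < t -> derivable (k p s x) t 1.
Proof. by move=> t0; apply: ex_derive; exact: is_derive_tricomi_integrand. Qed.

Lemma tricomi_integrand_FTC p s x a b : 0 < a -> a < b ->
  \int[mu]_(t in `[a, b])
    (p * k (p - 1) s x t + s * k p (s - 1) x t - x * k p s x t) =
  k p s x b - k p s x a.
Proof.
move=> a0 ab.
have der t : t \in `[a, b] -> 0 < t.
  by rewrite in_itv/= => /andP[at_ _]; exact: lt_le_trans at_.
rewrite /Rintegral (@continuous_FTC2 R _ (k p s x))//.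
- apply: derivable_within_continuous => t /der t0.
  apply: derivableB; first apply: derivableD.
  + by apply: derivableM => //; exact: derivable_tricomi_integrand.
  + by apply: derivableM => //; exact: derivable_tricomi_integrand.
  + by apply: derivableM => //; exact: derivable_tricomi_integrand.
- have cont t : 0 < t -> {for t, continuous (k p s x)}.
    move=> t0; apply/differentiable_continuous/derivable1_diffP.
    exact: derivable_tricomi_integrand.
  split.
  + move=> t tab; apply: derivable_tricomi_integrand.
    by apply: der; apply: subset_itv_oo_cc.
  + exact/cvg_at_right_filter/cont.
  + by apply/cvg_at_left_filter/cont; exact: lt_trans ab.
- move=> t tab; rewrite derive1E.
  have t0 : 0 < t by apply: der; exact: subset_itv_oo_cc.
  by have [] := is_derive_tricomi_integrand p s x t t0.
Qed.

Lemma tricomi_integrand_integrable_itv p s x a b : 0 < a ->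
  mu.-integrable `[a, b] (EFin \o k p s x).
Proof.
move=> a0; apply: continuous_compact_integrable; first exact: segment_compact.
apply: derivable_within_continuous => t; rewrite in_itv/= => /andP[at_ _].
by apply: derivable_tricomi_integrand; exact: lt_le_trans at_.
Qed.

(** Compare with the Taylor term of order [n + 1 >= r] in [expR (x * (t + 1))]. *)
Lemma powR_expR_bound r x : 0 < x ->
  exists2 C, 0 < C & forall t, 0 <= t -> (t + 1) `^ r * expR (- (t * x)) <= C.
Proof.
move=> x0; pose n := Num.bound r.
have rn : r <= n.+1%:R.
  have [r0|r0] := leP 0 r; last by rewrite (le_trans (ltW r0)).
  by rewrite (le_trans (ltW (archi_boundP r0)))// ler_nat.
exists (n.+1`!%:R * x ^- n.+1 * expR x).
  by rewrite !mulr_gt0 ?invr_gt0 ?exprn_gt0 ?expR_gt0// ltr0n fact_gt0.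
move=> t t0; have t1 : 0 <= t + 1 by rewrite addr_ge0.
apply: (@le_trans _ _ ((t + 1) ^+ n.+1 * expR (- (t * x)))).
  rewrite ler_wpM2r ?expR_ge0// -powR_mulrn//.
  by apply: ler_powR => //; rewrite lerDr.
have y0 : 0 <= x * (t + 1) by rewrite mulr_ge0// ltW.
have F0 : 0 < n.+1`!%:R :> R by rewrite ltr0n fact_gt0.
have X0 : 0 < x ^+ n.+1 by rewrite exprn_gt0.
have : (x * (t + 1)) ^+ n.+1 / n.+1`!%:R <= expR (x * (t + 1)).
  by apply: le_trans (expR_ge1Dxn n y0); rewrite lerDr.
have -> : expR (x * (t + 1)) = expR x * expR (t * x).
  by rewrite -expRD; congr expR; ring.
rewrite ler_pdivrMr// exprMn -ler_pdivlMl// expRN ler_pdivrMr ?expR_gt0//.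
by move=> /le_trans; apply; rewrite le_eqVlt; apply/orP; left; apply/eqP; ring.
Qed.

(** Compact intervals away from [0], where negative powers of [t] are harmless
    and the fundamental theorem of calculus applies directly. *)
Definition exhaustion (i : nat) : set R := `[i.+1%:R^-1, i.+1%:R].

Lemma exhaustion_nd : nondecreasing_seq exhaustion.
Proof.
move=> i j ij; apply/subsetPset => t; rewrite /exhaustion/= !in_itv/=.
move=> /andP[it ti]; apply/andP; split.
  by apply: le_trans it; rewrite lef_pV2 ?posrE// ler_nat.
by rewrite (le_trans ti)// ler_nat.
Qed.

Lemma bigcup_exhaustion : \bigcup_i exhaustion i = `]0, +oo[%classic.
Proof.
apply/seteqP; split => t /=.
  move=> [i _]; rewrite /exhaustion/= !in_itv/= andbT => /andP[+ _].
  by apply: lt_le_trans; rewrite invr_gt0.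
rewrite in_itv/= andbT => t0; pose n := maxn (Num.bound t) (Num.bound t^-1).
exists n => //; rewrite /exhaustion /= in_itv/=; apply/andP; split.
  rewrite -[leRHS]invrK lef_pV2 ?posrE ?invr_gt0//.
  rewrite (le_trans (ltW (archi_boundP _))) ?invr_ge0 ?(ltW t0)// ler_nat.
  by rewrite (leq_trans (leq_maxr _ _) (leqnSn _)).
rewrite (le_trans (ltW (archi_boundP (ltW t0))))// ler_nat.
by rewrite (leq_trans (leq_maxl _ _) (leqnSn _)).
Qed.

Lemma exhaustion_cvg p s x :
  (\int[mu]_(t in exhaustion i) (k p s x t)%:E @[i --> \oo] -->
   \int[mu]_(t in `]0%R, +oo[) (k p s x t)%:E)%E.
Proof.
rewrite -bigcup_exhaustion; apply: ge0_nondecreasing_set_cvg_integral.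
- exact: exhaustion_nd.
- by move=> i; exact: measurable_itv.
- move=> i; apply/measurable_EFinP/measurable_funTS.
  exact: measurable_tricomi_integrand.
- by move=> i t _; rewrite lee_fin tricomi_integrand_ge0.
Qed.

End TricomiIntegrals.

Section TricomiRecurrences.
Variable R : realType.
Local Notation mu := (@lebesgue_measure R).
Local Notation k := (@tricomi_integrand R).
Implicit Types p s x t z alpha beta : R.

Lemma exhaustion_itv i : (0 < i)%N ->
  0 < i.+1%:R^-1 :> R /\ i.+1%:R^-1 < i.+1%:R :> R.
Proof.
move=> i0; split; first by rewrite invr_gt0.
by rewrite (@lt_trans _ _ 1)// ?invf_lt1 ?ltr1n.
Qed.

(** The exponent [- (p + 2)] is the one for which a primitive is elementary:
    [(t / (t + 1)) ^ (p + 1) / (p + 1)], which is bounded. This integrand serves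
    below as a dominating function near [0]. *)
Lemma beta_integrable p : -1 < p ->
  mu.-integrable `]0%R, +oo[ (EFin \o k p (- (p + 2)) 0).
Proof.
move=> p1; have p0 : 0 < p + 1 by lra.
have mk := measurable_tricomi_integrand R p (- (p + 2)) 0.
apply/integrableP; split; first exact/measurable_EFinP/measurable_funTS.
under eq_integral do rewrite gee0_abs ?lee_fin ?tricomi_integrand_ge0//.
apply: (@le_lt_trans _ _ ((p + 1)^-1)%:E); last exact: ltry.
apply: (cvge_to_le (exhaustion_cvg R p (- (p + 2)) 0)).
exists 1%N => // i /= i0; have [a0 ab] := exhaustion_itv i i0.
have ik := tricomi_integrand_integrable_itv R p (- (p + 2)) 0 _ i.+1%:R a0.
rewrite -[leLHS]fineK ?(integrable_fin_num _ ik)// lee_fin.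
rewrite -[leRHS]mulr1 ler_pdivlMl//.
have := tricomi_integrand_FTC R (p + 1) (- (p + 1)) 0 _ _ a0 ab.
have -> : \int[mu]_(t in `[i.+1%:R^-1, i.+1%:R])
    ((p + 1) * k (p + 1 - 1) (- (p + 1)) 0 t +
     - (p + 1) * k (p + 1) (- (p + 1) - 1) 0 t -
     0 * k (p + 1) (- (p + 1)) 0 t) =
    \int[mu]_(t in `[i.+1%:R^-1, i.+1%:R]) ((p + 1) * k p (- (p + 2)) 0 t).
  apply: eq_Rintegral => t; rewrite inE/= in_itv/= => /andP[at_ _].
  have t0 : 0 < t by exact: lt_le_trans at_.
  have := tricomi_integrand_split R p (- (p + 2)) 0 t t0.
  have -> : - (p + 2) + 1 = - (p + 1) by ring.
  have -> : p + 1 - 1 = p by ring.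
  have -> : - (p + 1) - 1 = - (p + 2) by ring.
  by move=> ->; ring.
rewrite RintegralZl// => ->.
rewrite lerBlDr ler_wpDr ?tricomi_integrand_ge0//.
rewrite /tricomi_integrand mulr0 oppr0 expR0 mulr1 powRN.
rewrite ler_pdivrMr ?powR_gt0// mul1r.
by rewrite ge0_ler_powR ?nnegrE ?(ltW p0)// lerDl.
Qed.

Lemma tricomi_integrable p s x : -1 < p -> 0 < x ->
  mu.-integrable `]0%R, +oo[ (EFin \o k p s x).
Proof.
move=> p1 x0; have [C C0 CP] := powR_expR_bound R (s + p + 2) x x0.
have iG := beta_integrable p p1.
apply: (le_integrable _ _ _ (integrableZl _ C iG)) => //.
- by apply/measurable_EFinP/measurable_funTS; exact: measurable_tricomi_integrand.
- move=> t /=; rewrite in_itv/= andbT => t0.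
  rewrite lee_fin ger0_norm ?tricomi_integrand_ge0//.
  rewrite ger0_norm; last first.
    by apply: mulr_ge0; [exact: ltW|exact: tricomi_integrand_ge0].
  have t10 : 0 < t + 1 by rewrite addr_gt0.
  have -> : k p s x t =
     ((t + 1) `^ (s + p + 2) * expR (- (t * x))) * k p (- (p + 2)) 0 t.
    rewrite /tricomi_integrand mulr0 oppr0 expR0 mulr1.
    have -> : s = (s + p + 2) + - (p + 2) by ring.
    rewrite powRD; last by rewrite (gt_eqF t10) implybT.
    rewrite (_ : s + p + 2 - (p + 2) + p + 2 = s + p + 2); ring.
  by rewrite ler_wpM2r ?tricomi_integrand_ge0// CP// ltW.
Qed.

Definition tricomi_integral p s x : R := \int[mu]_(t in `]0, +oo[) k p s x t.

Lemma tricomi_integral_exhaustion p s x : -1 < p -> 0 < x ->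
  \int[mu]_(t in exhaustion R i) k p s x t @[i --> \oo] -->
  tricomi_integral p s x.
Proof.
move=> p1 x0; apply: fine_cvg; rewrite fineK.
  exact: exhaustion_cvg.
exact: integrable_fin_num (tricomi_integrable p s x p1 x0).
Qed.

Lemma tricomi_integral_split p s x : -1 < p -> 0 < x ->
  tricomi_integral p (s + 1) x =
  tricomi_integral (p + 1) s x + tricomi_integral p s x.
Proof.
move=> p1 x0; rewrite /tricomi_integral -RintegralD//; last 2 first.
- by apply: tricomi_integrable => //; lra.
- exact: tricomi_integrable.
apply: eq_Rintegral => t; rewrite inE/= in_itv/= andbT.
exact: tricomi_integrand_split.
Qed.

(** Integrate the derivative of the integrand over an exhaustion; the boundary
    terms vanish at [0] because [p > 0] and at infinity because [x > 0]. *)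
Lemma tricomi_integral_by_parts p s x : 0 < p -> 0 < x ->
  x * tricomi_integral p s x =
  p * tricomi_integral (p - 1) s x + s * tricomi_integral p (s - 1) x.
Proof.
move=> p0 x0; have p1 : -1 < p by lra. have pp1 : -1 < p - 1 by lra.
pose bnd (i : nat) := k p s x i.+1%:R - k p s x i.+1%:R^-1.
have bnd_cvg : bnd i @[i --> \oo] --> (0 : R).
  rewrite -[X in _ --> X](subr0 (0 : R)); apply: cvgB.
    have [C C0 CP] := powR_expR_bound R (s + p + 1) x x0.
    apply: (@squeeze_cvgr _ _ _ _ (cst 0) (fun i => C * harmonic i)).
    - near=> i; rewrite tricomi_integrand_ge0/=.
      set t : R := i.+1%:R; have t0 : 0 < t by [].
      have t10 : 0 < t + 1 by rewrite addr_gt0.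
      rewrite ler_pdivlMr//; apply: le_trans (CP t (ltW t0)).
      rewrite (_ : s + p + 1 = p + s + 1); last by ring.
      rewrite powR_succ// powRD; last by rewrite (gt_eqF t10) implybT.
      rewrite /tricomi_integrand (mulrAC _ (expR _)) ler_wpM2r ?expR_ge0//.
      rewrite ler_pM ?mulr_ge0 ?powR_ge0 ?(ltW t0)// ?lerDl//.
      rewrite ler_wpM2r ?powR_ge0//.
      by rewrite ge0_ler_powR ?nnegrE ?(ltW p0) ?(ltW t0) ?(ltW t10)// lerDl.
    - exact: cvg_cst.
    - by rewrite -[X in _ --> X](mulr0 C); apply: cvgMr; exact: cvg_harmonic.
  have [C C0 CP] := powR_expR_bound R s x x0.
  apply: (@squeeze_cvgr _ _ _ _ (cst 0) (fun i => harmonic i `^ p * C)).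
  - near=> i; rewrite tricomi_integrand_ge0/= /tricomi_integrand -mulrA.
    by rewrite ler_wpM2l ?powR_ge0// CP.
  - exact: cvg_cst.
  - rewrite -[X in _ --> X](mul0r C); apply: cvgMl.
    apply: ((cvg_at_rightP (fun u : R => u `^ p) 0 0).1
      (powR_cvg0 p0) (@harmonic R)).
    by split=> [i|]; [exact: harmonic_gt0|exact: cvg_harmonic].
have cvgI q r : -1 < q ->
    \int[mu]_(t in exhaustion R i) k q r x t @[i --> \oo] -->
    tricomi_integral q r x.
  by move=> q1; exact: tricomi_integral_exhaustion.
have lim1 : p * \int[mu]_(t in exhaustion R i) k (p - 1) s x t +
    s * \int[mu]_(t in exhaustion R i) k p (s - 1) x t -
    x * \int[mu]_(t in exhaustion R i) k p s x t @[i --> \oo] -->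
  p * tricomi_integral (p - 1) s x + s * tricomi_integral p (s - 1) x -
    x * tricomi_integral p s x.
  by apply: cvgB; first apply: cvgD; apply: cvgMr; exact: cvgI.
apply/eqP; rewrite eq_sym -subr_eq0; apply/eqP.
apply: (cvg_unique _ lim1) => //=.
apply: cvg_trans bnd_cvg; apply: near_eq_cvg; near=> i.
have i0 : (0 < i)%N by near: i; exact: nbhs_infty_gt.
have [a0 ab] := exhaustion_itv i i0.
have ik q r := tricomi_integrand_integrable_itv R q r x _ i.+1%:R a0.
rewrite /bnd -tricomi_integrand_FTC//.
have iZ c q r : mu.-integrable `[i.+1%:R^-1, i.+1%:R]
    (EFin \o (fun t => c * k q r x t)).
  exact: (integrableZl _ c (ik q r)).
rewrite RintegralB//; last exact: (integrableD _ (iZ p (p - 1) s) (iZ s p (s - 1))).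
by rewrite RintegralD// !RintegralZl.
Unshelve. all: by end_near. Qed.

Lemma tricomi_integral_gt0 p s x : -1 < p -> 0 < x -> 0 < tricomi_integral p s x.
Proof.
move=> p1 x0; have i12 := tricomi_integrand_integrable_itv R p s x 1 2 ltr01.
have [||c c12 cmin] := @EVT_min R (k p s x) 1 2.
- lra.
- apply: derivable_within_continuous => t; rewrite in_itv/= => /andP[t1 _].
  by apply: derivable_tricomi_integrand; exact: lt_le_trans t1.
have c0 : 0 < c.
  by move: c12; rewrite in_itv/= => /andP[c1 _]; exact: lt_le_trans c1.
apply: (@lt_le_trans _ _ (k p s x c)); first exact: tricomi_integrand_gt0.
apply: (@le_trans _ _ (\int[mu]_(t in `[1, 2]) k p s x t)).
  have -> : k p s x c = \int[mu]_(t in `[1, 2]) (k p s x c).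
    rewrite Rintegral_cst//= lebesgue_measure_itv/= lte_fin ltr1n.
    by rewrite -EFinB/= (_ : 2 - 1 = 1 :> R) ?mulr1//; ring.
  apply: le_Rintegral => //.
  exact: nondecreasing_integrable.
apply: fine_le; first exact: integrable_fin_num i12.
  exact: integrable_fin_num (tricomi_integrable p s x p1 x0).
apply: ge0_subset_integral => //.
- apply/measurable_EFinP/measurable_funTS; exact: measurable_tricomi_integrand.
- by move=> t _; rewrite lee_fin tricomi_integrand_ge0.
- by move=> t /=; rewrite !in_itv/= andbT => /andP[t1 _]; exact: lt_le_trans t1.
Qed.

Lemma Gamma_tricomi z : Gamma z = tricomi_integral (z - 1) 0 1.
Proof.
rewrite /Gamma /tricomi_integral; apply: eq_Rintegral => t _.
by rewrite /tricomi_integrand powRr0 !mulr1.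
Qed.

Lemma Gamma_gt0 z : 0 < z -> 0 < Gamma z.
Proof. by move=> z0; rewrite Gamma_tricomi tricomi_integral_gt0//; lra. Qed.

(** The second exponent being [0], integration by parts has a single term. *)
Lemma GammaS z : 0 < z -> Gamma (z + 1) = z * Gamma z.
Proof.
move=> z0; rewrite !Gamma_tricomi addrK.
by rewrite -[LHS]mul1r tricomi_integral_by_parts// mul0r addr0.
Qed.

Lemma tricomiU_integral alpha beta x :
  tricomiU alpha beta x =
  (Gamma alpha)^-1 * tricomi_integral (alpha - 1) (beta - alpha - 1) x.
Proof. by []. Qed.

Lemma tricomiU_gt0 alpha beta x : 0 < alpha -> 0 < x -> 0 < tricomiU alpha beta x.
Proof.
move=> al0 x0; rewrite tricomiU_integral mulr_gt0 ?invr_gt0 ?Gamma_gt0//.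
by rewrite tricomi_integral_gt0//; lra.
Qed.

(** Write [(t + 1) ^ (s + 1)] as [t (t + 1) ^ s + (t + 1) ^ s] under the
    integral. *)
Lemma tricomiU_contiguous alpha beta x : 0 < alpha -> 0 < x ->
  tricomiU alpha (beta + 1) x =
  tricomiU alpha beta x + alpha * tricomiU (alpha + 1) (beta + 1) x.
Proof.
move=> al0 x0; rewrite !tricomiU_integral GammaS// addrK.
have -> : beta + 1 - alpha - 1 = (beta - alpha - 1) + 1 by ring.
have -> : beta + 1 - (alpha + 1) - 1 = beta - alpha - 1 by ring.
rewrite tricomi_integral_split//; last lra.
rewrite subrK; field.
by rewrite !gt_eqF// Gamma_gt0.
Qed.

Lemma tricomiU_by_parts alpha beta x : 0 < alpha -> 0 < x ->
  tricomiU alpha beta x =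
  (alpha + 1 - beta) * tricomiU (alpha + 1) beta x +
  x * tricomiU (alpha + 1) (beta + 1) x.
Proof.
move=> al0 x0; rewrite !tricomiU_integral GammaS// addrK.
have -> : beta + 1 - (alpha + 1) - 1 = beta - alpha - 1 by ring.
have -> : beta - (alpha + 1) - 1 = (beta - alpha - 1) - 1 by ring.
rewrite (mulrCA x) tricomi_integral_by_parts//; field.
by rewrite !gt_eqF// Gamma_gt0.
Qed.

End TricomiRecurrences.

(** * The ratio of consecutive Tricomi functions and the weights *)

Section TricomiRatio.
Variable R : realType.
Local Notation mu := (@lebesgue_measure R).

(** With [u n = U(c + n, beta)] and [v n = U(c + n + 1, beta + 1)], integration
    by parts reads [u n = g n u (n + 1) + x v n], and splitting a power of
    [t + 1] reads [v n = u (n + 1) + a n v (n + 1)]. Dividing, the quotients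
    [q n = x v n / u n] satisfy the recurrence of the continued fraction, whose
    value is [u 1 / u 0]. *)
Lemma tricomi_ratio_stieltjes (c beta : R) : 0 < c -> beta < c + 1 ->
  exists Y : R -> R,
    [/\ {homo Y : u v / u <= v}, forall u, 0 <= Y u <= 1 &
        forall x, 0 < x ->
          tricomiU (c + 1) beta x / tricomiU c beta x =
          \int[mu]_(u in `[0, 1]) stieltjes_kernel R x (Y u)].
Proof.
move=> c0 cb.
pose g (n : nat) : R := c + n%:R + 1 - beta; pose a (n : nat) : R := c + n%:R + 1.
have n0 (n : nat) : 0 <= n%:R :> R by [].
have g0 n : 0 < g n by have := n0 n; rewrite /g; lra.
have a0 n : 0 < a n by have := n0 n; rewrite /a; lra.
apply: (@stieltjes_limit R (fun N x => cf_approx R g a x N 0)) => [N|x x0].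
  have [m [t [m0 t0 m1 mt]]] := resolvent_entry_sum R N (cf_matrix R g a N).
  exists N.+1, m, t; split => // x x0.
  rewrite -(mt x _ x0 (cf_matrix_resolvent R g a x g0 a0 x0 N)).
  by rewrite mxE.
pose u n := tricomiU (c + n%:R) beta x.
pose v n := tricomiU (c + n%:R + 1) (beta + 1) x.
have cn n : 0 < c + n%:R by have := n0 n; lra.
have u0 n : 0 < u n by exact: tricomiU_gt0.
have v0 n : 0 < v n by apply: tricomiU_gt0 => //; exact: addr_gt0.
have cS n : c + n.+1%:R = c + n%:R + 1 by rewrite -natr1 addrA.
have uE n : u n = g n * u n.+1 + x * v n.
  by rewrite /u /v /g cS; exact: tricomiU_by_parts.
have vE n : v n = u n.+1 + a n * v n.+1.
  by rewrite /u /v /a !cS tricomiU_contiguous// addr_gt0.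
pose q n := x * v n / u n.
have denomE n : x + g n + a n * q n.+1 = u n / u n.+1.
  rewrite /q (uE n) (vE n); field.
  by rewrite gt_eqF.
have -> : tricomiU (c + 1) beta x / tricomiU c beta x =
    (x + g 0 + a 0 * q 1)^-1.
  by rewrite denomE invf_div /u addr0.
apply: (@cf_approx_cvg R g a x g0 a0 x0 q _ _ (g 0 + 1)) => n.
- by rewrite /q divr_gt0// mulr_gt0.
- rewrite denomE /q (vE n); field.
  by rewrite !gt_eqF.
- have := n0 n; have := g0 0; rewrite /g -natr1 addr0; nra.
Qed.

End TricomiRatio.

Section Weights.
Variable R : realType.
Local Notation mu := (@lebesgue_measure R).

(** Measurability in the parameter [x] comes from Tonelli's theorem. *)
Lemma measurable_tricomi_integral p s :
  measurable_fun setT (tricomi_integral R p s).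
Proof.
pose f (z : R * R) : \bar R :=
  ((tricomi_integrand R p s z.1 z.2) * \1_(`]0, +oo[%classic : set R) z.2)%:E.
have mf : measurable_fun setT f.
  apply/measurable_EFinP; apply: measurable_funM.
    apply: measurable_funM; first apply: measurable_funM.
    - by apply: (measurableT_comp (measurable_powR _)); exact: measurable_snd.
    - apply: (measurableT_comp (measurable_powR _)).
      by apply: measurable_funD => //; exact: measurable_snd.
    - do 2 apply: measurableT_comp => //.
      by apply: measurable_funM; [exact: measurable_snd|exact: measurable_fst].
  by apply: measurableT_comp; [exact: measurable_indic|exact: measurable_snd].
have f0 z : (0 <= f z)%E.
  by rewrite lee_fin mulr_ge0 ?tricomi_integrand_ge0.
have mF := measurable_fun_fubini_tonelli_F (m2 := mu) f mf f0.
have -> : tricomi_integral R p s = fine \o fubini_F mu f.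
  apply/funext => x; rewrite /tricomi_integral /Rintegral /= /fubini_F.
  rewrite [in LHS]integral_mkcond; congr (fine (integral _ _ _)); apply/funext => t.
  by rewrite patchE /f /= indicE; case: ifPn; rewrite ?mulr1 ?mulr0.
exact: measurableT_comp.
Qed.

Lemma measurable_tricomiU alpha beta : measurable_fun setT (@tricomiU R alpha beta).
Proof.
rewrite (_ : tricomiU _ _ = fun x => (Gamma alpha)^-1 *
  tricomi_integral R (alpha - 1) (beta - alpha - 1) x)//.
by apply: measurable_funM => //; exact: measurable_tricomi_integral.
Qed.

Lemma measurable_weightW a b c : measurable_fun setT (@weightW R a b c).
Proof.
apply: measurable_funM; last exact: measurable_tricomiU.
apply: measurable_funM; last exact: measurable_powR.
apply: measurable_funM => //.
by apply: measurableT_comp => //; exact: measurable_oppr.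
Qed.

Lemma weight_measure_exists (w : R -> R) :
  measurable_fun setT w -> (forall x, 0 < x -> 0 <= w x) ->
  exists m : {measure set (measurableTypeR R) -> \bar R},
    [/\ weight_measure `]0, +oo[ w m, m (~` `]0, +oo[) = 0%E &
     forall A : set R, measurable A -> A `<=` `]0, +oo[ ->
       forall f : R -> R, measurable_fun A f -> (forall x, A x -> 0 <= f x) ->
       (\int[m]_(x in A) (f x)%:E = \int[mu]_(x in A) (f x * w x)%:E)%E].
Proof.
move=> mw w0; pose D : set R := `]0, +oo[%classic.
have mD : measurable D by exact: measurable_itv.
have mwD : measurable_fun setT (w \_ D).
  by apply/(measurable_restrictT _ mD); exact: measurable_funTS.
have wD0 x : 0 <= (w \_ D) x.
  rewrite patchE; case: ifPn => // /set_mem; rewrite /D/= in_itv/= andbT.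
  exact: w0.
pose m : {measure set (measurableTypeR R) -> \bar R} := density mu mwD wD0.
have mE (A : set R) : measurable A -> m A = (\int[mu]_(x in A `&` D) (w x)%:E)%E.
  by move=> mA; rewrite /m/= /density integral_mkcondr restrict_EFin.
exists m; split.
- split => //; first exact: measurable_funTS.
  by move=> x; rewrite /= in_itv/= andbT; exact: w0.
- by rewrite mE ?setICl ?integral_set0//; exact: measurableC.
- move=> A mA AD f mf f0.
  rewrite (@ge0_integral_density _ _ _ mu m (w \_ D))//.
  + apply: eq_integral => x /set_mem Ax.
    by rewrite patchE mem_set ?EFinM//; exact: AD.
  + exact/measurable_EFinP.
Qed.

End Weights.

Theorem theorem2p1 (R : realType) (a b c : R) (ha : -1 < a) (hb : -1 < b)
    (hc : Num.max 0 (a - b) < c) :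
  nikishin_weights `]0, +oo[ (weightW a b c) (weightW a b (c + 1)).
Proof.
have [c0 cab] : 0 < c /\ a - b < c by move: hc; rewrite gt_max => /andP[].
have a1 : 0 < a + 1 by lra.
have b1 : 0 < b + 1 by lra.
have cb1 : 0 < c + b + 1 by lra.
have wE c' x : weightW a b c' x =
    Gamma (c' + b + 1) / (Gamma (a + 1) * Gamma (b + 1)) *
    expR (- x) * x `^ a * tricomiU c' (a - b + 1) x by [].
have w0 c' x : 0 < c' -> 0 < c' + b + 1 -> 0 < x -> 0 < weightW a b c' x.
  move=> c'0 cb'0 x0; rewrite wE mulr_gt0 ?tricomiU_gt0//.
  by rewrite !mulr_gt0 ?invr_gt0 ?mulr_gt0 ?Gamma_gt0 ?expR_gt0 ?powR_gt0.
have [mu0 [w_mu0 mu0C mu0E]] :=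
  weight_measure_exists R _ (measurable_weightW R a b c)
    (fun x x0 => ltW (w0 c x c0 cb1 x0)).
have c10 : 0 < c + 1 by lra.
have cb2 : 0 < c + 1 + b + 1 by lra.
have [mu1 [w_mu1 mu1C _]] :=
  weight_measure_exists R _ (measurable_weightW R a b (c + 1))
    (fun x x0 => ltW (w0 (c + 1) x c10 cb2 x0)).
have [|Y [Y_nd Y01 YE]] := tricomi_ratio_stieltjes R c (a - b + 1) c0; first lra.
(* c + b + 1 is the quotient of the gamma factors of the two weights *)
have [sigma [sigmaC sigmaE]] :=
  stieltjes_measure R Y (c + b + 1) (ltW cb1) Y_nd Y01.
pose f x := \int[sigma]_(t in `]-oo, 0]) (x - t)^-1.
have fE x : 0 < x -> f x = (c + b + 1) *
    (tricomiU (c + 1) (a - b + 1) x / tricomiU c (a - b + 1) x).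
  by move=> x0; rewrite /f (sigmaE x x0).2 YE.
have fw x : 0 < x -> f x * weightW a b c x = weightW a b (c + 1) x.
  move=> x0; rewrite fE// !wE.
  have -> : c + 1 + b + 1 = (c + b + 1) + 1 by ring.
  rewrite (GammaS R (c + b + 1))//; field.
  by rewrite !gt_eqF ?Gamma_gt0 ?tricomiU_gt0.
have f0 x : 0 < x -> 0 <= f x.
  move=> x0; rewrite fE//.
  by rewrite mulr_ge0 ?divr_ge0// ltW// tricomiU_gt0.
have mf : measurable_fun (`]0, +oo[%classic : set R) f.
  apply: (eq_measurable_fun (fun x => (c + b + 1) *
    (tricomiU (c + 1) (a - b + 1) x * tricomiU c (a - b + 1) x `^ (-1)))).
    move=> x; rewrite inE/= in_itv/= andbT => x0.
    by rewrite fE// powR_inv1// ltW// tricomiU_gt0.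
  apply: measurable_funTS; apply: measurable_funM => //; apply: measurable_funM.
    exact: measurable_tricomiU.
  by apply: (measurableT_comp (measurable_powR _)); exact: measurable_tricomiU.
exists mu0, mu1; split => //; split => //; first exact: interval_is_interval.
exists `]-oo, 0]%classic, sigma; split => //.
- exact: interval_is_interval.
- by apply/seteqP; split => // x [] /=; rewrite !in_itv/= andbT => /lt_geF ->.
- by move=> x; rewrite /= in_itv/= andbT => /sigmaE[].
- split => // A mA AD.
  have [_ _ ->//] := w_mu1; rewrite (setIidl AD) mu0E//; last 2 first.
  + exact: measurable_funS mf.
  + by move=> x /AD; rewrite /= in_itv/= andbT; exact: f0.
  apply: eq_integral => x /set_mem/AD; rewrite /= in_itv/= andbT => x0.
  by rewrite fw.
Qed.
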